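(* Let $n$ be an odd positive integer such that $D=n^2+1$ is squarefree, and suppose $h(D)=1$. Then $D$ is a quadratic residue modulo at least one of the primes $5,7,41,61,1861$.
   Context: For a squarefree integer $D>1$, $h(D)$ denotes the class number of the real quadratic field $\mathbb{Q}(\sqrt D)$. Here ''$D$ is a quadratic residue modulo the prime $p$'' means that $D$ is congruent to a square modulo $p$ (the residue $0$ being allowed), i.e. the Legendre symbol $\left(\frac{D}{p}\right)$ is not $-1$. *)

(* Defs.v *)
From mathcomp Require Import all_boot all_order all_algebra all_field.
From mathcomp Require Import finmap.
From mathcomp Require Import boolp classical_sets cardinality.

Set Implicit Arguments.
Unset Strict Implicit.
Unset Printing Implicit Defensive.

Import GRing.Theory Num.Theory.

Local Open Scope ring_scope.
Local Open Scope classical_set_scope.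

Definition squarefree (D : nat) : Prop :=
  forall d : nat, (d ^ 2 %| D)%N -> d = 1%N.

(* The residue 0 is allowed: for p an odd prime, this says that the Legendre
   symbol (D / p) is not -1. *)
Definition quadratic_residue (p D : nat) : Prop :=
  exists x : nat, x ^ 2 = D %[mod p].

(* Number fields are handled as subsets of the field of complex algebraic
   numbers. *)
Definition quadratic_field (D : nat) : set algC :=
  [set x | exists a b : rat, x = ratr a + ratr b * sqrtC D%:R].

Definition ring_of_integers (K : set algC) : set algC :=
  [set x | K x /\ x \in Aint].

Record nonzero_ideal (O : set algC) (I : set algC) : Prop := NonzeroIdeal {
  ideal_sub : I `<=` O;
  ideal_zero : I 0;
  ideal_add : forall x y, I x -> I y -> I (x + y);
  ideal_mul : forall a x, O a -> I x -> I (a * x);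
  ideal_neq0 : exists2 x, I x & x != 0
}.

(* I ~ J when a I = b J for some nonzero a, b in O; for integral ideals this
   is equality modulo principal fractional ideals. *)
Definition ideal_equiv (O : set algC) (I J : set algC) : Prop :=
  exists a b : algC, [/\ O a, O b, a != 0, b != 0 &
    [set a * x | x in I] = [set b * y | y in J]].

Definition ideal_class (O : set algC) (I : set algC) : set (set algC) :=
  [set J | nonzero_ideal O J /\ ideal_equiv O I J].

Definition class_group (O : set algC) : set (set (set algC)) :=
  [set ideal_class O I | I in nonzero_ideal O].

(* fset_set A is the empty fset when A is infinite, so this would be 0 if the
   class group were infinite. *)
Definition class_number (K : set algC) : nat :=
  #|` fset_set (class_group (ring_of_integers K))|%fset.

Definition h (D : nat) : nat := class_number (quadratic_field D).

(* Main.v *)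
(* As n is odd, D = n^2 + 1 is 2 modulo 4, so 2 ramifies in Q(sqrt D) and its
   prime (2, sqrt D) has norm 2.  If h(D) = 1 this prime is principal, hence
   x^2 - D y^2 = 2 or -2 has an integer solution.  Descent along the unit
   n + sqrt D of norm -1 excludes this for n > 1, so D = 2 = 3^2 (mod 7): only
   the prime 7 is ever needed. *)
Require Import Defs.
From mathcomp Require Import all_boot all_order all_algebra all_field.
From mathcomp Require Import finmap.
From mathcomp Require Import boolp classical_sets cardinality.
From mathcomp Require Import ring zify.

Set Implicit Arguments.
Unset Strict Implicit.
Unset Printing Implicit Defensive.

Import Order.TTheory GRing.Theory Num.Theory.

Section RealQuadratic.
Local Open Scope ring_scope.
Local Open Scope classical_set_scope.

Local Notation ratrC := (ratr : {rmorphism rat -> algC}).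

(** * Descent for x^2 - D y^2 = 2 or -2 *)

(* Infinite descent in y: multiplying x + y sqrt D by the unit - n + sqrt D of
   norm -1 negates the norm and replaces y by x - n y. *)
Lemma norm_neq2 (n y x : nat) (s : int) : (1 < n)%N -> s ^+ 2 = 4 ->
  (x : int) ^+ 2 - (n ^ 2 + 1)%N%:Z * (y : int) ^+ 2 <> s.
Proof.
move=> n1 s2; have {s2} : s = 2 \/ s = - 2 by nia.
elim/ltn_ind: y x s => y IH x s s2 E.
have {}E : (x : int) ^+ 2 = (n%:Z * y%:Z) ^+ 2 + (y : int) ^+ 2 + s.
  by rewrite -E; lia.
have y0 : (0 < y)%N.
  case: (posnP y) E => // ->; rewrite mulr0 expr0n /= !add0r => E.
  by case: x E => [|[|x]] E; [lia|lia|nia].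
(* For y = 1, x^2 is n^2 - 1 or n^2 + 3; as n > 1, both lie strictly between (n - 1)^2 and (n + 1)^2
   and differ from n^2. *)
have [y1|y1] : y = 1%N \/ (1 < y)%N by lia.
  rewrite {}y1 in E.
  have xn : (n <= x)%N by nia.
  have [e|{}xn] : x = n \/ (n < x)%N by lia.
    by rewrite e in E; lia.
  nia.
(* For y > 1 the bounds n y < x < (n + 1) y follow, so 0 < x - n y < y. *)
have y2 : 4 <= (y : int) ^+ 2 by nia.
have x1 : n%:Z * y%:Z < x.
  by rewrite -(@ltr_pXn2r _ 2%N) ?nnegrE //; lia.
have ny : 2 * (y : int) ^+ 2 <= n%:Z * (y : int) ^+ 2 by nia.
have x2 : x%:Z < n%:Z * y%:Z + y%:Z.
  by rewrite -(@ltr_pXn2r _ 2%N) ?nnegrE //; lia.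
have y'y : (x - n * y < y)%N by lia.
have s2' : - s = 2 \/ - s = - 2 by lia.
(* The product with - n + sqrt D has rational part D y - n x; its absolute value is taken to stay in
   [nat]. *)
apply: (IH _ y'y (absz (n%:Z * x%:Z - (n%:Z ^+ 2 + 1) * y%:Z)%R) _ s2').
rewrite abszE real_normK ?num_real //.
have -> : (x - n * y)%N%:Z = x%:Z - n%:Z * y%:Z by lia.
have -> : (n ^ 2 + 1)%N%:Z = n%:Z ^+ 2 + 1 by lia.
have -> : s = x%:Z ^+ 2 - (n%:Z * y%:Z) ^+ 2 - y%:Z ^+ 2 by rewrite E; ring.
ring.
Qed.

(** * Denominators and irrationality *)

(** The square of the denominator of q is coprime to that of the numerator, so it divides D and must
    be 1. *)
Lemma squarefree_int (D : nat) (q : rat) : squarefree D ->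
  D%:R * q ^+ 2 \is a Num.int -> q \is a Num.int.
Proof.
move=> Dsf /intrP[m Em].
have Eq : (numq q)%:~R = q * (denq q)%:~R.
  by rewrite -{2}(divq_num_den q) divfK // intr_eq0 denq_neq0.
have {}Em : D%:Z * numq q ^+ 2 = m * denq q ^+ 2.
  by apply: (@intr_inj rat); rewrite !intrM -Em Eq -[D%:~R]/(D%:R); ring.
have dD : (`|denq q| ^ 2 %| D)%N.
  have : (denq q ^+ 2 %| D%:Z * numq q ^+ 2)%Z by rewrite Em dvdz_mull.
  rewrite dvdzE abszX abszM abszX Gauss_dvdl //.
  by rewrite coprimeXl // coprimeXr // coprime_sym coprime_num_den.
have d1 : denq q = 1 by have := Dsf _ dD; have := denq_gt0 q; lia.
by rewrite -(divq_num_den q) d1 divr1 intr_int.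
Qed.

(** If sqrt D = q, then D (q / D)^2 = 1, so q / D is an integer m with D m^2 = 1, against D > 1. *)
Lemma sqrtC_irrational (D : nat) (q : rat) : squarefree D -> (1 < D)%N ->
  sqrtC D%:R != ratr q :> algC.
Proof.
move=> Dsf D1; apply/eqP => /(congr1 (fun x => x ^+ 2)).
rewrite sqrtCK -(rmorphXn ratrC) /= -[LHS](ratr_nat algC).
move/(fmorph_inj ratrC) => E.
have D0 : D%:R != 0 :> rat by rewrite pnatr_eq0; lia.
have E1 : D%:R * (q / D%:R) ^+ 2 = 1 by rewrite expr_div_n -E; field.
have : q / D%:R \is a Num.int.
  by apply: (squarefree_int Dsf); rewrite E1 int_num1.
move=> /intrP[m Em]; rewrite Em in E1.
have : D%:Z * m ^+ 2 = 1 by apply: (@intr_inj rat); rewrite !intrM; exact: E1.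
have [->|m0] := eqVneq m 0; first by rewrite expr0n mulr0.
have m1 : 1 <= m ^+ 2 by nia.
nia.
Qed.

(** * Conjugation and the integers of Q(sqrt D) *)

Section Conjugation.
Variables (D : nat) (D_sqfree : squarefree D) (D_gt1 : (1 < D)%N).
Local Notation r := (sqrtC D%:R : algC).

Lemma quad_inj (a b c d : rat) :
  ratr a + ratr b * r = ratr c + ratr d * r -> a = c /\ b = d.
Proof.
move=> E; have [bd|bd] := eqVneq b d.
  by move: E; rewrite bd => /addIr /(fmorph_inj ratrC).
have /eqP[] := sqrtC_irrational ((c - a) / (b - d)) D_sqfree D_gt1.
have bd0 : ratr b - ratr d != 0 :> algC.
  by rewrite subr_eq0; apply: contra_neq bd => /(fmorph_inj ratrC).
apply: (mulfI bd0); rewrite fmorph_div !rmorphB /=.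
rewrite [RHS]mulrC divfK //.
have -> : ratr c = ratr a + ratr b * r - ratr d * r by rewrite E addrK.
ring.
Qed.

(** A rational polynomial takes conjugate values u + v sqrt D and u - v sqrt D at x and x', so the
    minimal polynomial of x also vanishes at x'. *)
Lemma Aint_conj (a b : rat) :
  ratr a + ratr b * r \in Aint -> ratr a - ratr b * r \in Aint.
Proof.
set x := _ + _; set x' := _ - _ => xA.
suff x'0 : root (minCpoly x) x'
  by apply: root_monic_Aint x'0 (minCpoly_monic x) xA.
have [p [Ep _] _] := minCpolyP x.
have [u [v [Eu Ev]]] : exists u v : rat,
    (map_poly ratr p).[x] = ratr u + ratr v * r /\
    (map_poly ratr p).[x'] = ratr u - ratr v * r.
  elim/poly_ind: (p) => [|q c [u [v [Eu Ev]]]].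
    by exists 0, 0; rewrite !rmorph0 !horner0 mul0r subr0 addr0.
  exists (u * a + D%:R * v * b + c), (u * b + v * a).
  have step z : (map_poly ratr (q * 'X + c%:P)).[z] =
      (map_poly ratr q).[z] * z + ratr c :> algC.
    by rewrite rmorphD rmorphM /= map_polyX map_polyC !hornerE.
  rewrite !{}step Eu Ev /x /x' !(rmorphD, rmorphM) /= !ratr_nat.
  (* Replacing D by s^2 leaves polynomial identities in s. *)
  have := sqrtCK (D%:R : algC); set s := sqrtC _; move: s => s <-.
  by split; ring.
have := root_minCpoly x; rewrite Ep => /rootP; rewrite Eu => E0.
have [u0 v0] : u = 0 /\ v = 0.
  by apply: quad_inj; rewrite E0 !rmorph0 mul0r addr0.
by apply/rootP; rewrite Ev u0 v0 !rmorph0 mul0r subr0.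
Qed.

Lemma Aint_ratr (q : rat) : ratr q \in Aint -> q \is a Num.int.
Proof.
move=> qA; have /intrP[m Em] := Cint_rat_Aint (Crat_rat q) qA.
apply/intrP; exists m; apply: (fmorph_inj ratrC).
by rewrite /= Em ratr_int.
Qed.

(* For x = a + b sqrt D, 2a and 2b are integers because the trace 2a and the
   norm a^2 - D b^2 are; they are even because D = 2 (mod 4). *)
Lemma quadratic_integersP (x : algC) : (D %% 4 = 2)%N ->
  ring_of_integers (quadratic_field D) x <->
  exists a b : int, x = a%:~R + b%:~R * r.
Proof.
move=> D4; split=> [[[a [b ->]] xA]|[a [b ->]]]; last first.
  split; first by exists a%:~R, b%:~R; rewrite !ratr_int.
  have rA : r \in Aint.
    apply: (@root_monic_Aint ('X^2 - D%:R%:P)).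
    - by apply/rootP; rewrite !hornerE sqrtCK subrr.
    - by rewrite monicXnsubC.
    - apply/polyOverP => i; rewrite !coefE; case: (i == 2); case: (i == 0) => /=;
      rewrite ?subr0 ?sub0r ?rpredN ?rpredB ?rpred_nat //.
  by rewrite rpredD ?rpredM ?Aint_int.
have x'A := Aint_conj xA.
have /Aint_ratr/intrP[t Et] : ratr (2 * a) \in Aint.
  suff -> : ratr (2 * a) = (ratr a + ratr b * r) + (ratr a - ratr b * r).
    by rewrite rpredD.
  by rewrite rmorphM /= ratr_nat; ring.
have /Aint_ratr/intrP[N EN] : ratr (a ^+ 2 - D%:R * b ^+ 2) \in Aint.
  suff -> : ratr (a ^+ 2 - D%:R * b ^+ 2) =
      (ratr a + ratr b * r) * (ratr a - ratr b * r).
    by rewrite rpredM.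
  rewrite !expr2 !(rmorphB, rmorphM) /= ratr_nat.
  have := sqrtCK (D%:R : algC); set s := sqrtC _; move: s => s <-.
  ring.
(* D (2b)^2 = t^2 - 4 N is an integer. *)
have /intrP[s Es] : 2 * b \is a Num.int.
  apply: (squarefree_int D_sqfree); apply/intrP; exists (t ^+ 2 - 4 * N).
  by rewrite intrB expr2 !intrM -Et -EN; ring.
have E : t ^+ 2 - D%:Z * s ^+ 2 = 4 * N.
  apply: (@intr_inj rat).
  rewrite !expr2 intrB !intrM -Et -EN -Es -[D%:~R]/(D%:R); ring.
have half (c : int) (q : rat) : 2 * q = c%:~R -> (2 %| c)%Z ->
    ratr q = (c %/ 2)%Z%:~R :> algC.
  move=> Eq c2; rewrite -(ratr_int algC); congr ratr.
  have n2 : 2 != 0 :> rat by [].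
  apply: (mulfI n2); rewrite Eq -{1}(divzK c2) intrM mulrC //.
have [k Dk] : exists k : int, D%:Z = 4 * k + 2 by exists (D %/ 4)%N%:Z; lia.
have t2 : (2 %| t)%Z.
  have : (2 %| t ^+ 2)%Z.
    apply/dvdzP; exists (2 * N + (2 * k + 1) * s ^+ 2).
    by rewrite Dk in E; lia.
  by rewrite !dvdzE abszX Euclid_dvdX // => /andP[].
(* With t = 2u, halving the norm equation gives 2 u^2 - (2k + 1) s^2 = 2 N. *)
have s2 : (2 %| s)%Z.
  have /dvdzP[u Eu] := t2.
  have : (2 %| s ^+ 2)%Z.
    apply/dvdzP; exists (u ^+ 2 - N - k * s ^+ 2).
    by rewrite Dk Eu in E *; lia.
  by rewrite !dvdzE abszX Euclid_dvdX // => /andP[].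
by exists (t %/ 2)%Z, (s %/ 2)%Z; rewrite -(half t a) // -(half s b).
Qed.

End Conjugation.

(** * From class number 1 to a norm 2 or -2 *)

(** Cardinality 1 rules out the default empty value of [fset_set], so all ideals share one class;
    [JJ] puts J in it. *)
Lemma class_number1_equiv (K I J : set algC) :
  class_number K = 1%N -> nonzero_ideal (ring_of_integers K) I ->
  nonzero_ideal (ring_of_integers K) J ->
  ideal_equiv (ring_of_integers K) J J -> ideal_equiv (ring_of_integers K) I J.
Proof.
set O := ring_of_integers K => hK I0 J0 JJ.
have [X clX] : exists X, forall L, nonzero_ideal O L -> ideal_class O L = X.
  move: hK; rewrite /class_number /fset_set; case: pselect => [fin|];
    last by rewrite cardfs0.
  case: cid => F /= EF /eqP/cardfs1P[X FX]; exists X => L L0.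
  have : class_group O (ideal_class O L) by exists L.
  by rewrite EF FX /= inE => /eqP.
have : ideal_class O J J by [].
by rewrite (clX J J0) -(clX I I0) => -[].
Qed.

(* The ideal (2, sqrt D) consists of the 2a + b sqrt D, and the norm of a
   generator divides both 4 and D and is even. *)
Lemma class_number1_norm2 (D : nat) : squarefree D -> (D %% 4 = 2)%N ->
  h D = 1%N -> exists (x y : nat) (s : int),
    s ^+ 2 = 4 /\ (x : int) ^+ 2 - D%:Z * (y : int) ^+ 2 = s.
Proof.
move=> Dsf D4 hD; have D1 : (1 < D)%N by case: D D4 {Dsf hD} => [|[]].
set r : algC := sqrtC D%:R; pose O := ring_of_integers (quadratic_field D).
have OP x : O x <-> exists a b : int, x = a%:~R + b%:~R * r.
  exact: quadratic_integersP.
have r2 : r * r = D%:R by rewrite -expr2 sqrtCK.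
have inj (a b c d : int) : a%:~R + b%:~R * r = c%:~R + d%:~R * r ->
    a = c /\ b = d.
  rewrite -!(ratr_int algC) => /(quad_inj Dsf D1)[/intr_inj-> /intr_inj->] //.
have mulE (a b c d : int) : (a%:~R + b%:~R * r) * (c%:~R + d%:~R * r) =
    (a * c + D%:Z * (b * d))%:~R + (a * d + b * c)%:~R * r.
  by rewrite !intrD !intrM -[(Posz D)%:~R]/(D%:R) -r2; ring.
have OD x y : O x -> O y -> O (x + y).
  move=> /OP[a [b ->]] /OP[c [d ->]]; apply/OP; exists (a + c), (b + d).
  by rewrite !intrD; ring.
have OM x y : O x -> O y -> O (x * y).
  move=> /OP[a [b ->]] /OP[c [d ->]]; apply/OP; rewrite mulE.
  by eexists; eexists.
have O0 : O 0 by apply/OP; exists 0, 0; rewrite mul0r addr0.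
have O1 : O 1 by apply/OP; exists 1, 0; rewrite mul0r addr0.
have O_ideal : nonzero_ideal O O.
  by split=> //; exists 1 => //; exact: oner_neq0.
have [k Dk] : exists k : int, D%:Z = 2 * (2 * k + 1).
  by exists (D %/ 4)%N%:Z; lia.
pose I : set algC := [set x | exists a b : int, x = (2 * a)%:~R + b%:~R * r].
have I_ideal : nonzero_ideal O I.
  split.
  - by move=> x [a [b ->]]; apply/OP; exists (2 * a), b.
  - by exists 0, 0; rewrite mulr0 mul0r addr0.
  - move=> x y [a [b ->]] [c [d ->]]; exists (a + c), (b + d).
    by rewrite mulrDr !intrD; ring.
  - move=> x y /OP[a [b ->]] [c [d ->]].
    exists (a * c + (2 * k + 1) * (b * d)), (a * d + b * (2 * c)).
    by rewrite mulE; congr (_%:~R + _); rewrite Dk; ring.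
  - exists 2; last by rewrite pnatr_eq0.
    by exists 1, 0; rewrite mul0r addr0 mulr1.
have OO : ideal_equiv O O O.
  by exists 1, 1; split=> //; exact: oner_neq0.
have [al [be [_ _ al0 be0 E]]] := class_number1_equiv hD I_ideal O_ideal OO.
(* As 1 is in O, be = al ga for some ga in I; cancelling al shows that ga generates I. *)
have [ga [u [v ga_uv]] Ega] : [set al * x | x in I] be.
  by rewrite E; exists 1 => //; rewrite mulr1.
have gaP x : I x -> exists2 y, O y & ga * y = x.
  move=> Ix; have : [set al * x | x in I] (al * x) by exists x.
  by rewrite E => -[y Oy]; rewrite -Ega -mulrA => /(mulfI al0); exists y.
have [|_ /OP[c [d ->]]] := gaP 2.
  by exists 1, 0; rewrite mul0r addr0 mulr1.
have E2 : 2 = (2 : int)%:~R + (0 : int)%:~R * r by rewrite mul0r addr0.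
rewrite ga_uv mulE => gaE; have /inj[c2 d2] := etrans gaE E2.
have [|_ /OP[e [f ->]]] := gaP r.
  by exists 0, 1; rewrite mulr0 add0r mul1r.
have Er : r = (0 : int)%:~R + (1 : int)%:~R * r by rewrite mul1r add0r.
rewrite ga_uv mulE => gaE'; have /inj[e2 f2] := etrans gaE' Er.
(* The norm of ga is 4 u^2 - D v^2 = 2 m. Taking norms in the factorizations of 2 and sqrt D by ga
   shows that m divides 2 and the odd number 2k + 1. *)
pose m := 2 * u ^+ 2 - (2 * k + 1) * v ^+ 2.
have m2 : m * (c ^+ 2 - D%:Z * d ^+ 2) = 2.
  apply: (@mulfI _ 2) => //.
  have -> : 2 * (m * (c ^+ 2 - D%:Z * d ^+ 2)) =
    (2 * u * c + D%:Z * (v * d)) ^+ 2 - D%:Z * (2 * u * d + v * c) ^+ 2.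
    by rewrite /m Dk; ring.
  by rewrite c2 d2; ring.
have mk : m * (e ^+ 2 - D%:Z * f ^+ 2) = - (2 * k + 1).
  apply: (@mulfI _ 2) => //.
  have -> : 2 * (m * (e ^+ 2 - D%:Z * f ^+ 2)) =
    (2 * u * e + D%:Z * (v * f)) ^+ 2 - D%:Z * (2 * u * f + v * e) ^+ 2.
    by rewrite /m Dk; ring.
  by rewrite e2 f2 Dk; ring.
have m1 : m = 1 \/ m = - 1.
  move: mk; set w := e ^+ 2 - _; move: m2; set z := c ^+ 2 - _.
  move: m w z => m w z mz mw; have m_le : -2 <= m <= 2.
    have z0 : z != 0 by apply/eqP => z0; rewrite z0 mulr0 in mz.
    have {z0} [z0|z0] : z <= -1 \/ 1 <= z by lia.
      by apply/andP; split; nia.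
    by apply/andP; split; nia.
  have : m = -2 \/ m = -1 \/ m = 0 \/ m = 1 \/ m = 2 by lia.
  by case=> [|[|[|[|]]]] mE; move: mw mz; rewrite mE; lia.
exists (absz (2 * u)%R), (absz v), (2 * m); split; first by case: m1 => ->.
by rewrite !abszE !real_normK ?num_real // Dk /m; ring.
Qed.

End RealQuadratic.

Theorem theorem1p5 (n : nat) (n_gt0 : 0 < n) (n_odd : odd n)
    (D_sqfree : squarefree (n ^ 2 + 1)) (hD1 : h (n ^ 2 + 1) = 1) :
  exists2 p : nat, p \in [:: 5; 7; 41; 61; 1861] &
    quadratic_residue p (n ^ 2 + 1).
Proof.
have [->|n_gt1] : n = 1 \/ 1 < n by lia.
  by exists 7; last exists 3.
have D4 : (n ^ 2 + 1) %% 4 = 2.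
  have [k ->] : exists k, n = 2 * k + 1 by exists n./2; lia.
  have -> : (2 * k + 1) ^ 2 + 1 = (k * k + k) * 4 + 2 by lia.
  by rewrite modnMDl.
have [x [y [s [s2 E]]]] := class_number1_norm2 D_sqfree D4 hD1.
(* The case n > 1 is contradictory. *)
by case: (norm_neq2 n_gt1 s2 E).
Qed.
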